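(* Let $S$ be a reduced commutative semigroup with $0$ and suppose that $\Gamma(S)$ is a complete $r$-partite graph with parts $V_1,V_2,\dots,V_r$. Then for every $1\le t\le r$, $V_t\cup\{0\}$ is an ideal of $S$ and $\mathfrak p_t=Z(S)\setminus V_t$ is a prime ideal of $S$.
   Context: A commutative semigroup with $0$ is a commutative semigroup $S$ with an element $0$ such that $0s=0$ for all $s\in S$. A zero-divisor is an element $x\in S$ with $xy=0$ for some $y\in S$, $y\neq 0$; $Z(S)$ is the set of zero-divisors. The zero-divisor graph $\Gamma(S)$ is the simple undirected graph with vertex set $Z(S)\setminus\{0\}$, where distinct $x,y$ are adjacent iff $xy=0$. $S$ is reduced if for all $x\in S$ and $n\ge 1$, $x^n=0$ implies $x=0$. A non-empty subset $I\subseteq S$ is an ideal if $xS\subseteq I$ for every $x\in I$; an ideal $\mathfrak p$ is prime if for all $x,y\in S$, $xSy\subseteq\mathfrak p$ implies $x\in\mathfrak p$ or $y\in\mathfrak p$. A graph is complete $r$-partite with parts $V_1,\dots,V_r$ if its vertex set is partitioned into the (non-empty) subsets $V_1,\dots,V_r$, no edge has both ends in the same $V_i$, and each vertex is joined to every vertex not in the same subset. *)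

(* Defs.v *)
From HB Require Import structures.
From mathcomp Require Import all_boot.
From mathcomp Require Import boolp classical_sets.

Set Implicit Arguments.
Unset Strict Implicit.
Unset Printing Implicit Defensive.

Local Open Scope classical_set_scope.
Local Open Scope group_scope.

HB.mixin Record Semigroup_isComSemigroupWithZero S of Semigroup S := {
  szero : S;
  smulC : commutative (@mul S);
  smul0 : forall s : S, mul szero s = szero
}.

#[short(type="comSemigroupWithZeroType")]
HB.structure Definition ComSemigroupWithZero :=
  {S of Semigroup_isComSemigroupWithZero S & Semigroup S}.

Notation "0" := (@szero _) : group_scope.

Section SemigroupWithZero.
Variable S : comSemigroupWithZeroType.
Implicit Types (x y : S) (I p : set S).

(* [iterop n mul x x] is the product of [n] copies of [x] when [0 < n];
   a semigroup need not have a unit, so there is no zeroth power. *)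
Definition reduced : Prop :=
  forall x (n : nat), (0 < n)%N -> iterop n mul x x = 0 -> x = 0.

Definition zero_divisors : set S :=
  [set x | exists y : S, x * y = 0 /\ y <> 0].

Definition ideal I : Prop :=
  I !=set0 /\ forall x, I x -> [set x * s | s in [set: S]] `<=` I.

(* A prime ideal is not required to be proper. *)
Definition prime_ideal p : Prop :=
  ideal p /\
  forall x y, [set x * s * y | s in [set: S]] `<=` p -> p x \/ p y.

End SemigroupWithZero.

Arguments reduced : clear implicits.
Arguments zero_divisors : clear implicits.

Record simple_graph (T : Type) := SimpleGraph {
  vertices : set T;
  adjacent : T -> T -> Prop;
  adjacent_vertices :
    forall x y, adjacent x y -> vertices x /\ vertices y;
  adjacent_sym : forall x y, adjacent x y -> adjacent y x;
  adjacent_irrefl : forall x, ~ adjacent x x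
}.

Section ZeroDivisorGraph.
Variable S : comSemigroupWithZeroType.

Definition zdg_vertices : set S := zero_divisors S `\ 0.

Definition zdg_adjacent (x y : S) : Prop :=
  [/\ zdg_vertices x, zdg_vertices y, x <> y & x * y = 0].

Fact zdg_adjacent_vertices x y :
  zdg_adjacent x y -> zdg_vertices x /\ zdg_vertices y.
Proof. by case. Qed.

Fact zdg_adjacent_sym x y : zdg_adjacent x y -> zdg_adjacent y x.
Proof. by case=> xV yV /nesym yx xy0; split; rewrite // smulC. Qed.

Fact zdg_adjacent_irrefl x : ~ zdg_adjacent x x.
Proof. by case. Qed.

Definition zero_divisor_graph : simple_graph S :=
  SimpleGraph zdg_adjacent_vertices zdg_adjacent_sym zdg_adjacent_irrefl.

End ZeroDivisorGraph.

(* [partition] requires the parts to be non-empty, pairwise disjoint, and to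
   cover the vertex set. *)
Definition complete_multipartite (T : Type) (G : simple_graph T) (r : nat)
    (V : 'I_r -> set T) : Prop :=
  [/\ partition [set: 'I_r] V (vertices G),
      forall i x y, V i x -> V i y -> ~ adjacent G x y
    & forall x y, vertices G x -> vertices G y ->
        ~ (exists i, V i x /\ V i y) -> adjacent G x y].

(* Main.v *)
(** Since [S] is reduced, [x * y = 0] with [x] and [y] in parts forces the parts
    to be different.  If [x] is in [V t] and [x * s <> 0], then [x * s] is a
    vertex, and it cannot lie in another part, since then
    [(x * s) * x = 0], hence [(x * s)^2 = 0].  For primality, multiplication by
    an element outside [Z(S) \ V t] maps [V t] to itself, so [x * v * y] stays
    in [V t] for every [v] in [V t]. *)

Require Import Defs.
From mathcomp Require Import all_boot.
From mathcomp Require Import boolp classical_sets.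

Set Implicit Arguments.
Unset Strict Implicit.
Unset Printing Implicit Defensive.

Local Open Scope classical_set_scope.
Local Open Scope group_scope.

Lemma reduced_square (S : comSemigroupWithZeroType) (hred : reduced S) (x : S) :
  x * x = 0 -> x = 0.
(* [iterop 2 mul x x] is convertible to [x * x]. *)
Proof. exact: (hred x 2). Qed.

Section Multipartite.
Variables (S : comSemigroupWithZeroType) (r : nat) (V : 'I_r -> set S).
Hypothesis hred : reduced S.
Hypothesis hV : complete_multipartite (zero_divisor_graph S) V.

Lemma part_vertex i x : V i x -> zdg_vertices x.
Proof.
case: hV => -[cov _ _] _ _ Vix.
by suff: vertices (zero_divisor_graph S) x by []; rewrite -cov; exists i.
Qed.

Lemma vertex_part x : zdg_vertices x -> exists i, V i x.
Proof.
case: hV => -[cov _ _] _ _ xV.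
have : vertices (zero_divisor_graph S) x by [].
by rewrite -cov => -[i _ Vix]; exists i.
Qed.

Lemma part_uniq i j x : V i x -> V j x -> i = j.
Proof. by case: hV => -[_ triv _] _ _ Vix Vjx; apply: triv => //; exists x. Qed.

(** Non-adjacency inside a part settles only [x <> y]; when [x = y] the product is a square, and
    reducedness applies. *)
Lemma part_mul_neq0 i x y : V i x -> V i y -> x * y <> 0.
Proof.
move=> Vix Viy xy0; case: hV => _ indep _.
have xV := part_vertex Vix; have yV := part_vertex Viy.
apply: (indep i x y Vix Viy); split => // xy.
by apply: xV.2; apply: (reduced_square hred); rewrite {2}xy.
Qed.

Lemma part_mul_eq0 i j x y : V i x -> V j y -> i <> j -> x * y = 0.
Proof.
move=> Vix Vjy ij; case: hV => _ _ compl.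
case: (compl x y (part_vertex Vix) (part_vertex Vjy)) => // -[k [Vkx Vky]].
by apply: ij; rewrite (part_uniq Vix Vkx) (part_uniq Vjy Vky).
Qed.

Lemma part_mul i x s : V i x -> x * s <> 0 -> V i (x * s).
Proof.
move=> Vix xs0.
have [[y [xy0 y0]] _] := part_vertex Vix.
have xsV : zdg_vertices (x * s).
  by split => //; exists y; split => //; rewrite (smulC x) -mulgA xy0 smulC smul0.
have [k Vk] := vertex_part xsV.
have [-> //|ik] := pselect (i = k).
by case: xs0; apply: (reduced_square hred); rewrite mulgA (smulC _ x)
  (part_mul_eq0 Vix Vk ik) smul0.
Qed.

(** Such an [x] is either not a zero-divisor or itself in [V i]. In both cases [x * v] is non-zero,
    so [part_mul] keeps it in [V i]. *)
Lemma part_mul_compl i x v :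
  ~ (zero_divisors S `\` V i) x -> V i v -> V i (x * v).
Proof.
move=> xp Viv; rewrite smulC; apply: part_mul => // vx0.
apply: xp; split; first by exists v; rewrite smulC; split => //; case: (part_vertex Viv).
by move=> Vix; apply: (part_mul_neq0 Viv Vix).
Qed.

Lemma part_neq0 i x : V i x -> x <> 0.
Proof. by case/part_vertex. Qed.

Lemma ideal_part i : ideal (V i `|` [set 0]).
Proof.
split; first by exists 0; right.
move=> x [Vix|->] _ [s _ <-]; last by right; rewrite /= smul0.
by have [->|xs0] := pselect (x * s = 0); [right|left; apply: part_mul].
Qed.

(** This set consists of [0] and the parts other than [V i], and a non-zero multiple of a vertex
    stays in the part of that vertex. *)
Lemma ideal_compl_part i : ideal (zero_divisors S `\` V i).
Proof.
have [v Viv] : V i !=set0 by case: hV => -[_ _ ne] _ _; exact: ne.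
have p0 : (zero_divisors S `\` V i) 0.
  split; last by move/part_neq0.
  (* [0] is a zero-divisor once [S] has a non-zero element; the non-empty part [V i] supplies
     one. *)
  by exists v; rewrite smul0; split => //; apply: part_neq0 Viv.
split; first by exists 0.
move=> x [xZ xVi] _ [s _ <-].
have [->//|xs0] := pselect (x * s = 0).
have xV : zdg_vertices x by split => // x0; apply: xs0; rewrite x0 smul0.
have [j Vjx] := vertex_part xV.
have Vjxs := part_mul Vjx xs0.
split; first by case: (part_vertex Vjxs).
by move=> Vixs; apply: xVi; rewrite (part_uniq Vixs Vjxs).
Qed.

Lemma prime_ideal_compl_part i : prime_ideal (zero_divisors S `\` V i).
Proof.
split=> [|x y xSy]; first exact: ideal_compl_part.
have [v Viv] : V i !=set0 by case: hV => -[_ _ ne] _ _; exact: ne.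
apply: contrapT => /not_orP[xp yp].
(* With [v] from [V i] as middle factor, [x * v * y] avoids [V i] by assumption on [x] and [y], yet
   two uses of [part_mul_compl] put it there. *)
have [_] : (zero_divisors S `\` V i) (x * v * y) by apply: xSy; exists v.
by apply; rewrite smulC; do 2?apply: part_mul_compl.
Qed.

End Multipartite.

Theorem theorem3p1 (S : comSemigroupWithZeroType) (r : nat)
    (V : 'I_r -> set S) (hred : reduced S)
    (hV : complete_multipartite (zero_divisor_graph S) V) (t : 'I_r) :
  ideal (V t `|` [set 0]) /\ prime_ideal (zero_divisors S `\` V t).
Proof. by split; [apply: ideal_part | apply: prime_ideal_compl_part]. Qed.
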